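(* Let $(M,\mathcal F,g_\intercal)$ be a transversely time-oriented Lorentzian foliation. If $(M,\mathcal F,g_\intercal)$ is transversely stably causal, then there exists a $C^0$-neighborhood $\mathcal U$ of $g_\intercal$ in $\mathcal{TL}(M,\mathcal F)$ such that $(M,\mathcal F,g'_\intercal)$ is transversely causal for every $g'_\intercal\in\mathcal U$.
   Context: $M$ is a connected smooth manifold of dimension $n\ge 3$. $\mathcal F$ is a regular foliation of codimension $q\geq 2$: a partition of $M$ into connected immersed submanifolds (leaves), locally given by the fibers of a submersion. $T\mathcal F\subset TM$ is the (vertical) distribution tangent to the leaves; vectors in $T\mathcal F$, and vector fields with values in it, are called vertical. A transverse Lorentzian metric on $(M,\mathcal F)$ is a smooth symmetric $(0,2)$-tensor field $g_\intercal$ on $M$ with $\mathcal L_Vg_\intercal=0$ for all vertical $V$, such that at each $x$ the bilinear form $g_\intercal(x)$ has index $1$ and its kernel is exactly $T_x\mathcal F$. $\mathcal{TL}(M,\mathcal F)$ is the set of these. The triple $(M,\mathcal F,g_\intercal)$ is then called a Lorentzian foliation. A nonvertical vector $v$ is transversely timelike if $g_\intercal(v,v)<0$ and transversely causal if $g_\intercal(v,v)\le 0$. The set of transversely causal vectors at $x$ has two connected components (causal wedges); a transverse time orientation is a continuous choice of one of them (the future causal wedge) at each point. A future-directed transversely causal (timelike) curve is a piecewise smooth curve whose tangent vectors are transversely causal (timelike) and lie in the future causal wedges. For leaves $L,L'$, write $L<_{M/\mathcal F}L'$ if there is a future-directed transversely causal curve from a point of $L$ to a point of $L'$. $(M,\mathcal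 F,g_\intercal)$ is transversely causal if $L\nless_{M/\mathcal F}L$ for every leaf $L$. For $g_\intercal,g'_\intercal\in\mathcal{TL}(M,\mathcal F)$, write $g_\intercal<g'_\intercal$ if for every $v\in TM\setminus T\mathcal F$, $g_\intercal(v,v)\le0\Rightarrow g'_\intercal(v,v)<0$; in that case $g'_\intercal$ is time-oriented so that its future wedges contain those of $g_\intercal$. $(M,\mathcal F,g_\intercal)$ is transversely stably causal if there is $g'_\intercal\in\mathcal{TL}(M,\mathcal F)$ with $g_\intercal<g'_\intercal$ and $(M,\mathcal F,g'_\intercal)$ transversely causal. The $C^0$ topology on $\mathcal{TL}(M,\mathcal F)$ is the one induced by the strong Whitney $C^0$ topology on smooth sections of the bundle of symmetric $(0,2)$-tensors on $M$. *)

(* Defs.v *)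
From Stdlib Require Import Relation_Operators.
From HB Require Import structures.
From mathcomp Require Import all_boot all_order all_algebra.
From mathcomp Require Import all_classical all_reals all_analysis.

Set Implicit Arguments.
Unset Strict Implicit.
Unset Printing Implicit Defensive.

Import Order.TTheory GRing.Theory Num.Theory.
Import numFieldNormedType.Exports.

Local Open Scope classical_set_scope.
Local Open Scope ring_scope.

Section SmoothMaps.
Context {R : realType} {V W : normedModType R}.

(* Only used with U open; f may take arbitrary values outside U. *)
Fixpoint Ck_on (k : nat) (U : set V) (f : V -> W) : Prop :=
  if k is k'.+1 then
    (forall x, U x -> differentiable f x) /\
    (forall v, Ck_on k' U (fun x => 'D_v f x))
  else forall x, U x -> {for x, continuous f}.

Definition smooth_on (U : set V) (f : V -> W) : Prop :=
  forall k, Ck_on k U f.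

End SmoothMaps.

Section BilinearForms.
Context {R : realType} {n : nat}.

Definition bilin (B : 'M[R]_n) (u w : 'rV[R]_n) : R :=
  (u *m B *m w^T) 0 0.

(* B is negative definite on the row space of W, of dimension m *)
Definition neg_def_on (m : nat) (B : 'M[R]_n) (W : 'M[R]_(m, n)) : Prop :=
  row_free W /\
  forall c : 'rV[R]_m, c != 0 -> bilin B (c *m W) (c *m W) < 0.

(* k is the largest dimension of a negative definite subspace *)
Definition has_index (B : 'M[R]_n) (k : nat) : Prop :=
  (exists W : 'M[R]_(k, n), neg_def_on B W) /\
  (forall m (W : 'M[R]_(m, n)), neg_def_on B W -> (m <= k)%N).

End BilinearForms.

(* [cinv] is total; it is the inverse of [cmap] only on the image of [cdom],
   and [cmap] is meaningful only on [cdom]. *)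
Record chart (R : realType) (n : nat) (M : topologicalType) := Chart {
  cdom : set M;
  cmap : M -> 'rV[R]_n;
  cinv : 'rV[R]_n -> M;
  cdom_open : open cdom;
  cimg_open : open (cmap @` cdom);
  cmapK : forall x, cdom x -> cinv (cmap x) = x;
  cmap_cont : forall x, cdom x -> {for x, continuous cmap};
  cinv_cont : forall y, (cmap @` cdom) y -> {for y, continuous cinv} }.

Definition cimg R n M (phi : chart R n M) : set 'rV[R]_n :=
  cmap phi @` cdom phi.

Definition transition R n M (phi psi : chart R n M) : 'rV[R]_n -> 'rV[R]_n :=
  cmap psi \o cinv phi.

Definition smoothly_compatible R n M (phi psi : chart R n M) : Prop :=
  smooth_on (cmap phi @` (cdom phi `&` cdom psi)) (transition phi psi) /\
  smooth_on (cmap psi @` (cdom phi `&` cdom psi)) (transition psi phi).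

Record smooth_manifold (R : realType) (n : nat) := SmoothManifold {
  msort :> topologicalType;
  m_hausdorff : hausdorff_space msort;
  m_second_countable : @second_countable msort;
  atlas : set (chart R n msort);
  atlas_cover : forall x, exists2 phi, atlas phi & cdom phi x;
  atlas_compatible : forall phi psi,
    atlas phi -> atlas psi -> smoothly_compatible phi psi;
  atlas_maximal : forall phi,
    (forall psi, atlas psi -> smoothly_compatible phi psi) -> atlas phi }.

Section Tensors.
Context {R : realType} {n : nat} (M : smooth_manifold R n).

Definition chart_at (x : M) (phi : chart R n M) : Prop :=
  atlas phi /\ cdom phi x.

(* A chart around x; everything computed with it below is independent of this
   choice, by the transformation laws [tlaw] and [slaw] and the chain rule. *)
Definition some_chart (x : M) : chart R n M := s2val (cid2 (atlas_cover x)).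

(* A tangent vector at [tpt] is the family of its components in the charts
   around [tpt]. The junk value 0 at the other charts makes the
   representation unique. *)
Record tangent := Tangent {
  tpt : M;
  tcomp : chart R n M -> 'rV[R]_n;
  tcomp_out : forall phi, ~ chart_at tpt phi -> tcomp phi = 0;
  tlaw : forall phi psi, chart_at tpt phi -> chart_at tpt psi ->
    tcomp psi = 'D_(tcomp phi) (transition phi psi) (cmap phi tpt) }.

(* A point of the bundle of symmetric (0,2)-tensors, in the same style. *)
Record symtensor := Symtensor {
  spt : M;
  scomp : chart R n M -> 'M[R]_n;
  scomp_out : forall phi, ~ chart_at spt phi -> scomp phi = 0;
  scomp_sym : forall phi, (scomp phi)^T = scomp phi;
  slaw : forall phi psi, chart_at spt phi -> chart_at spt psi ->
    forall u w : 'rV[R]_n,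
    bilin (scomp phi) u w =
    bilin (scomp psi) ('D_u (transition phi psi) (cmap phi spt))
                     ('D_w (transition phi psi) (cmap phi spt)) }.

Record symfield := Symfield {
  sf :> M -> symtensor;
  sf_pt : forall x, spt (sf x) = x;
  sf_smooth : forall phi, atlas phi ->
    smooth_on (cimg phi) (fun y => scomp (sf (cinv phi y)) phi) }.

(* g(v, w), for v and w with the same base point *)
Definition pairing (g : symfield) (v w : tangent) : R :=
  let phi := some_chart (tpt v) in
  bilin (scomp (g (tpt v)) phi) (tcomp v phi) (tcomp w phi).

Definition differential_at (q : nat) (s : M -> 'rV[R]_q) (v : tangent) :
    'rV[R]_q :=
  let phi := some_chart (tpt v) in
  'D_(tcomp v phi) (s \o cinv phi) (cmap phi (tpt v)).

Definition smooth_vector_field (X : M -> tangent) : Prop :=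
  (forall x, tpt (X x) = x) /\
  (forall phi, atlas phi ->
    smooth_on (cimg phi) (fun y => tcomp (X (cinv phi y)) phi)).

(* In the chart phi, at the point of coordinates y, and for constant
   coordinate fields u and w:
   (L_X g)(u, w) = X(g(u, w)) + g(D_u X, w) + g(u, D_w X). *)
Definition Lie_derivative (X : M -> tangent) (g : symfield)
    (phi : chart R n M) (y u w : 'rV[R]_n) : R :=
  let Xc := fun z => tcomp (X (cinv phi z)) phi in
  let G := fun z => scomp (g (cinv phi z)) phi in
  bilin ('D_(Xc y) G y) u w + bilin (G y) ('D_u Xc y) w
  + bilin (G y) u ('D_w Xc y).

Definition submersion_on (q : nat) (U : set M) (s : M -> 'rV[R]_q) : Prop :=
  (forall phi, atlas phi ->
    smooth_on (cmap phi @` (cdom phi `&` U)) (s \o cinv phi)) /\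
  (forall x, U x -> forall w, exists2 v, tpt v = x & differential_at s v = w).

(* Curves are parametrized by real numbers; values outside the interval are
   irrelevant. *)
Definition smooth_curve_on (a b : R) (c : R -> M) : Prop :=
  (forall t, a < t < b -> {for t, continuous c}) /\
  (forall phi, atlas phi ->
    smooth_on [set t : R | a < t < b /\ cdom phi (c t)] (cmap phi \o c)).

Definition velocity (c : R -> M) (t : R) (v : tangent) : Prop :=
  tpt v = c t /\
  forall phi, chart_at (c t) phi -> tcomp v phi = derive1 (cmap phi \o c) t.

(* O is open in the total space of the bundle of symmetric (0,2)-tensors, with
   the topology for which the bundle charts are homeomorphisms onto open
   subsets of R^n x Sym_n (the latter carrying the subspace topology). *)
Definition open_in_bundle (O : set symtensor) : Prop :=
  forall phi, atlas phi ->
  exists2 Om : set ('rV[R]_n * 'M[R]_n), open Om &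
    forall b, cdom phi (spt b) -> (O b <-> Om (cmap phi (spt b), scomp b phi)).

End Tensors.

(* A partition of M into leaves such that around each x there is a submersion
   [fol_sub x], defined on [fol_dom x], whose fibers are locally the leaves:
   the connected component of any y in (leaf of y) /\ [fol_dom x] is the
   connected component of y in its fiber. (A leaf may meet [fol_dom x] in
   infinitely many fibers, whence the components.) These components, the
   plaques, are the pieces from which the immersed submanifold structure of a
   leaf is glued, so a leaf is connected for its own manifold topology iff any
   two of its points are joined by a chain of plaques; connectedness in M
   would be too weak. *)
Section FoliationDef.
Context {R : realType} {n : nat} (M : smooth_manifold R n) (q : nat).

Definition plaque (dom : set M) (s : M -> 'rV[R]_q) (y : M) : set M :=
  connected_component (dom `&` s @^-1` [set s y]) y.

Record foliation := Foliation {
  leaf : M -> set M;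
  leaf_refl : forall x, leaf x x;
  leaf_eq : forall x y, leaf x y -> leaf x = leaf y;
  fol_dom : M -> set M;
  fol_sub : M -> M -> 'rV[R]_q;
  fol_dom_open : forall x, open (fol_dom x);
  fol_dom_refl : forall x, fol_dom x x;
  fol_submersion : forall x, submersion_on (fol_dom x) (fol_sub x);
  fol_leaf : forall x y, fol_dom x y ->
    connected_component (leaf y `&` fol_dom x) y
    = plaque (fol_dom x) (fol_sub x) y;
  leaf_connected : forall x y, leaf x y ->
    clos_refl_trans M
      (fun y1 y2 => exists2 z, fol_dom z y1 &
         plaque (fol_dom z) (fol_sub z) y1 y2) x y }.

End FoliationDef.

Section LorentzianFoliations.
Context {R : realType} {n : nat} {M : smooth_manifold R n} {q : nat}.
Variable F : foliation M q.

Definition vertical (v : tangent M) : Prop :=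
  differential_at (fol_sub F (tpt v)) v = 0.

Definition transverse_lorentzian : set (symfield M) :=
  [set g | [/\
    forall X, smooth_vector_field X -> (forall x, vertical (X x)) ->
      forall phi y u w, atlas phi -> cimg phi y ->
      Lie_derivative X g phi y u w = 0,
    forall x phi, chart_at x phi -> has_index (scomp (g x) phi) 1 &
    forall v, vertical v <-> (forall w, tpt w = tpt v -> pairing g v w = 0)]].

Definition trans_causal (g : symfield M) (v : tangent M) : Prop :=
  ~ vertical v /\ pairing g v v <= 0.

(* components, in the chart phi, of the vectors at x that belong to S *)
Definition comps_at (S : set (tangent M)) (x : M) (phi : chart R n M) :
    set 'rV[R]_n :=
  [set tcomp v phi | v in [set v | tpt v = x /\ S v]].

(* T is the set of all future causal vectors. Its part over each x is a
   connected component of the set of causal vectors at x, and it varies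
   continuously: locally T contains a continuous vector field, written
   x |-> X (cmap phi x) in a chart. *)
Definition time_orientation (g : symfield M) (T : set (tangent M)) : Prop :=
  (forall x phi, chart_at x phi ->
     exists2 u, comps_at (trans_causal g) x phi u &
       comps_at T x phi
       = connected_component (comps_at (trans_causal g) x phi) u) /\
  (forall x phi, chart_at x phi ->
     exists (U : set M) (X : 'rV[R]_n -> 'rV[R]_n),
       [/\ open U, U x, U `<=` cdom phi,
           forall y, U y -> {for cmap phi y, continuous X} &
           forall y, U y -> comps_at T y phi (X (cmap phi y))]).

(* On the piece [a, b] the curve c coincides with a curve d that is smooth on
   a larger open interval; d provides the one-sided velocities of c at a, b. *)
Definition future_causal_piece (g : symfield M) (T : set (tangent M))
    (c : R -> M) (a b : R) : Prop :=
  exists (d : R -> M) (a' b' : R),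
    [/\ a' < a, b < b', smooth_curve_on a' b' d &
      forall t, a <= t <= b ->
        d t = c t /\
        exists v, [/\ velocity d t v, trans_causal g v & T v]].

Definition future_causal_curve (g : symfield M) (T : set (tangent M))
    (c : R -> M) (a b : R) : Prop :=
  exists2 ts : seq R, path <%R a (rcons ts b) &
    forall i, (i <= size ts)%N ->
      future_causal_piece g T c
        (nth 0 (a :: rcons ts b) i) (nth 0 (a :: rcons ts b) i.+1).

Definition leaf_lt (g : symfield M) (T : set (tangent M)) (L L' : set M) :
    Prop :=
  exists (c : R -> M) (a b : R),
    [/\ future_causal_curve g T c a b, L (c a) & L' (c b)].

Definition transversely_causal (g : symfield M) (T : set (tangent M)) : Prop :=
  forall x, ~ leaf_lt g T (leaf F x) (leaf F x).

Definition metric_lt (g g' : symfield M) : Prop :=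
  forall v, ~ vertical v -> pairing g v v <= 0 -> pairing g' v v < 0.

Definition transversely_stably_causal (g : symfield M) (T : set (tangent M)) :
    Prop :=
  exists g' T', [/\ transverse_lorentzian g', metric_lt g g',
    time_orientation g' T', T `<=` T' & transversely_causal g' T'].

(* The strong Whitney C^0 topology has as a base the sets of sections with
   image in a given open set O of the bundle (they are closed under finite
   intersections); on transverse metrics the subspace topology is taken. *)
Definition C0_neighborhood (g : symfield M) (U : set (symfield M)) : Prop :=
  U `<=` transverse_lorentzian /\
  exists O : set (symtensor M),
    [/\ open_in_bundle O, forall x, O (g x) &
        forall h, transverse_lorentzian h -> (forall x, O (h x)) -> U h].

(* Transverse causality of a metric given without a time orientation: it admits
   one, and it is transversely causal for every one of them. (On a connected
   manifold there are then exactly two; passing from one to the other reverses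
   the future-directed curves, which does not affect L < L.) *)
Definition orientable_and_transversely_causal (g : symfield M) : Prop :=
  (exists T, time_orientation g T) /\
  (forall T, time_orientation g T -> transversely_causal g T).

End LorentzianFoliations.

(* Main.v *)
Require Import Defs.
From mathcomp Require Import all_boot all_order all_algebra.
From mathcomp Require Import all_classical all_reals all_analysis.
From mathcomp Require Import ring lra.

(** Let [g1 > g] be a transverse metric that is transversely causal. Comparing
    a tensor with [g1] on a complement of the vertical space, where the unit
    sphere is compact, is an open condition, so the transverse metrics [h] with
    [h < g1] contain a C^0-neighborhood of [g]. For such an [h], the timelike
    cones of [h] lie in those of [g1]: the future of [g1] induces a time
    orientation of [h] and, [M] being connected, any time orientation of [h] is
    this one or its opposite. Hence an [h]-causal curve from a leaf to itself
    is, possibly after reversal, a [g1]-causal one, which does not exist. *)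

Set Implicit Arguments.
Unset Strict Implicit.
Unset Printing Implicit Defensive.

Import Order.TTheory GRing.Theory Num.Theory.
Import numFieldNormedType.Exports.

Local Open Scope classical_set_scope.
Local Open Scope ring_scope.

(** * Entrywise convergence of matrices *)

Section MatrixConvergence.
Context {R : realType} (T : Type) (F : set_system T) {FF : Filter F}.

Lemma cvg_mxP m n (A_ : T -> 'M[R]_(m, n)) (A : 'M[R]_(m, n)) :
  A_ t @[t --> F] --> A <-> forall i j, A_ t i j @[t --> F] --> A i j.
Proof.
split=> [hA i j|hA].
  exact: continuous_cvg (@coord_continuous R m n i j A) hA.
apply/cvg_ballP => eps eps0.
have : \forall t \near F, forall i j, ball (A i j) eps (A_ t i j).
  apply: filter_forall => i; apply: filter_forall => j.
  by have /cvg_ballP := hA i j; exact.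
by apply: filterS => t ht; split.
Qed.

Lemma cvg_mulmx m n p (A_ : T -> 'M[R]_(m, n)) (B_ : T -> 'M[R]_(n, p))
    (A : 'M[R]_(m, n)) (B : 'M[R]_(n, p)) :
  A_ t @[t --> F] --> A -> B_ t @[t --> F] --> B ->
  A_ t *m B_ t @[t --> F] --> A *m B.
Proof.
move=> /cvg_mxP hA /cvg_mxP hB; apply/cvg_mxP => i j; rewrite mxE.
under eq_cvg do rewrite mxE.
by apply: cvg_big => [|k _]; [exact: add_continuous|exact: cvgM].
Qed.

Lemma cvg_trmx m n (A_ : T -> 'M[R]_(m, n)) (A : 'M[R]_(m, n)) :
  A_ t @[t --> F] --> A -> (A_ t)^T @[t --> F] --> A^T.
Proof.
move=> /cvg_mxP hA; apply/cvg_mxP => i j; rewrite mxE.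
by under eq_cvg do rewrite mxE; exact: hA.
Qed.

End MatrixConvergence.

(** * Linear algebra of degenerate forms of index one and their causal cones *)

Section BilinAlgebra.
Context {R : realType} {n : nat}.
Implicit Types (B : 'M[R]_n) (u v w e : 'rV[R]_n).

Lemma bilinDl B u v w : bilin B (u + v) w = bilin B u w + bilin B v w.
Proof. by rewrite /bilin !mulmxDl mxE. Qed.

Lemma bilinDr B u v w : bilin B w (u + v) = bilin B w u + bilin B w v.
Proof. by rewrite /bilin linearD mulmxDr mxE. Qed.

Lemma bilinZl B k u w : bilin B (k *: u) w = k * bilin B u w.
Proof. by rewrite /bilin -!scalemxAl mxE. Qed.

Lemma bilinZr B k u w : bilin B w (k *: u) = k * bilin B w u.
Proof. by rewrite /bilin linearZ -scalemxAr mxE. Qed.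

Lemma bilinNl B u w : bilin B (- u) w = - bilin B u w.
Proof. by rewrite -scaleN1r bilinZl mulN1r. Qed.

Lemma bilinNr B u w : bilin B w (- u) = - bilin B w u.
Proof. by rewrite -scaleN1r bilinZr mulN1r. Qed.

Lemma bilinC B u w : B^T = B -> bilin B u w = bilin B w u.
Proof.
move=> Bsym; rewrite /bilin -[in RHS]Bsym -[in RHS](trmxK w) -!trmx_mul mulmxA.
by rewrite [RHS]mxE.
Qed.

Lemma bilin0l B u w : u *m B = 0 -> bilin B u w = 0.
Proof. by rewrite /bilin => ->; rewrite mul0mx mxE. Qed.

Lemma bilin_nondeg B u : (forall w, bilin B u w = 0) -> u *m B = 0.
Proof.
move=> h; apply/rowP => j; rewrite mxE; have := h (delta_mx 0 j).
by rewrite /bilin trmx_delta -colE !mxE.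
Qed.

Lemma index1_exists B : has_index B 1 -> exists e, bilin B e e < 0.
Proof.
move=> [[W [_ hW]] _]; exists W; have := hW 1; rewrite mul1mx; apply.
by rewrite oner_eq0.
Qed.

(* Otherwise [e] and [u] would span a negative definite plane. *)
Lemma index1_orthogonal_ge0 B e u : B^T = B -> has_index B 1 ->
  bilin B e e < 0 -> bilin B e u = 0 -> 0 <= bilin B u u.
Proof.
move=> Bsym [_ hmax] he heu; rewrite leNgt; apply/negP => hu.
have hue : bilin B u e = 0 by rewrite bilinC.
have expand (c : 'rV[R]_(1 + 1)) : c *m col_mx e u = c 0 0 *: e + c 0 1 *: u.
  rewrite -{1}(hsubmxK c) mul_row_col.
  rewrite [lsubmx c]mx11_scalar [rsubmx c]mx11_scalar !mul_scalar_mx !mxE.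
  by congr (c _ _ *: _ + c _ _ *: _); apply/val_inj.
have neg (c : 'rV[R]_(1 + 1)) : c != 0 ->
    bilin B (c *m col_mx e u) (c *m col_mx e u) < 0.
  move=> c0; rewrite expand !(bilinDl, bilinDr, bilinZl, bilinZr) heu hue.
  set a := c 0 0; set b := c 0 1.
  have {c0} : (a != 0) || (b != 0).
    rewrite -negb_and; apply: contra c0 => /andP[/eqP a0 /eqP b0].
    apply/eqP/rowP => i; rewrite mxE.
    case: (unliftP 0 i) => [j|] ->; last exact: a0.
    by rewrite ord1 -[RHS]b0; congr (c _ _); apply/val_inj.
  rewrite (_ : _ + _ = a ^+ 2 * bilin B e e + b ^+ 2 * bilin B u u);
    last by ring.
  have a2 := sqr_ge0 a; have b2 := sqr_ge0 b.
  case/orP; rewrite -sqrf_eq0 neq_lt ltNge ?a2 ?b2 /= => h; nra.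
have : (2 <= 1)%N; last by [].
apply: (hmax 2 (col_mx e u)); split=> //.
apply: inj_row_free => c hc; apply/eqP; apply/negPn/negP => /neg.
by rewrite hc bilin0l ?ltxx // mul0mx.
Qed.

(** On the orthogonal of the timelike [e] the form is positive semidefinite, and a null vector of a
    semidefinite form is orthogonal to everything there. Since [u] is also orthogonal to [e], it
    lies in the kernel of [B]. *)
Lemma index1_orthogonal_ker B e u : B^T = B -> has_index B 1 ->
  bilin B e e < 0 -> bilin B e u = 0 -> bilin B u u <= 0 -> u *m B = 0.
Proof.
move=> Bsym Bind he heu hu.
have {}hu : bilin B u u = 0.
  by apply/eqP; rewrite eq_le hu (index1_orthogonal_ge0 Bsym Bind he heu).
have orth w : bilin B e w = 0 -> bilin B u w = 0.
  move=> hew; set b := bilin B u w; set c := bilin B w w.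
  have pos t : 0 <= 2 * t * b + t ^+ 2 * c.
    have /(index1_orthogonal_ge0 Bsym Bind he) : bilin B e (u + t *: w) = 0.
      by rewrite bilinDr bilinZr heu hew mulr0 addr0.
    rewrite !(bilinDl, bilinDr, bilinZl, bilinZr) hu (bilinC w u Bsym) -/b -/c.
    by rewrite (_ : _ + _ = 2 * t * b + t ^+ 2 * c); last by ring.
  have c0 : 0 <= c by apply: index1_orthogonal_ge0 hew.
  (* A parameter at which the quadratic in [t] is negative unless [b = 0]; dividing by [c + 1]
     rather than [c] also covers [c = 0]. *)
  have := pos (- b / (c + 1)).
  rewrite (_ : _ + _ = - (b / (c + 1)) ^+ 2 * (c + 2)).
    rewrite mulNr oppr_ge0 pmulr_lle0; last by rewrite ltr_wpDl.
    move=> h; have : (b / (c + 1)) ^+ 2 == 0 by rewrite eq_le h sqr_ge0.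
    rewrite sqrf_eq0 mulf_eq0 invr_eq0 => /orP[/eqP //|].
    by rewrite gt_eqF // ltr_wpDl.
  by field; rewrite gt_eqF // ltr_wpDl.
apply: bilin_nondeg => w.
(* An arbitrary [w] is reduced to its component orthogonal to [e]. *)
have : bilin B u (w - (bilin B e w / bilin B e e) *: e) = 0.
  by apply: orth; rewrite bilinDr bilinNr bilinZr divfK ?subrr ?lt_eqF.
by rewrite bilinDr bilinNr bilinZr (bilinC u e Bsym) heu mulr0 subr0.
Qed.

(** For a transverse metric the kernel of [B] is the vertical space, so the first condition says
    nonvertical. *)
Definition causal_set B : set 'rV[R]_n :=
  [set u | u *m B <> 0 /\ bilin B u u <= 0].

(** For timelike [e] and [B] of index one this is the causal wedge containing [e]. *)
Definition causal_cone B e : set 'rV[R]_n :=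
  [set u | bilin B u u <= 0 /\ bilin B e u < 0].

Lemma causal_cone_sub B e : B^T = B -> causal_cone B e `<=` causal_set B.
Proof.
move=> Bsym u [hu heu]; split=> // uB; move: heu.
by rewrite bilinC // bilin0l ?ltxx.
Qed.

Lemma causal_cone_self B e : bilin B e e < 0 -> causal_cone B e e.
Proof. by move=> he; split=> //; exact: ltW. Qed.

Lemma causal_cone_star B e u t : B^T = B -> bilin B e e < 0 ->
  causal_cone B e u -> 0 <= t <= 1 -> causal_cone B e (t *: e + (1 - t) *: u).
Proof.
move=> Bsym he [hu heu] /andP[t0 t1]; split.
  rewrite !(bilinDl, bilinDr, bilinZl, bilinZr) (bilinC u e Bsym).
  set a := bilin B e e in he *; set b := bilin B e u in heu *.
  set c := bilin B u u in hu *.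
  have := mulr_ge0 t0 t0; have s0 : 0 <= 1 - t by rewrite subr_ge0.
  have := mulr_ge0 t0 s0; have := mulr_ge0 s0 s0; set s := 1 - t; nra.
rewrite !(bilinDr, bilinZr); have s0 : 0 <= 1 - t by rewrite subr_ge0.
have [->|tn0] := eqVneq t 0; first by rewrite mul0r add0r subr0 mul1r.
have {tn0 t0} t0 : 0 < t by rewrite lt_def tn0.
set a := bilin B e e in he *; set b := bilin B e u in heu *.
have := mulr_ge0_le0 s0 (ltW heu); nra.
Qed.

(** The sign of [bilin B e u] decides; it cannot be zero, since a causal vector orthogonal to [e]
    would lie in the kernel. *)
Lemma causal_set_cone B e u : B^T = B -> has_index B 1 -> bilin B e e < 0 ->
  causal_set B u -> causal_cone B e u \/ causal_cone B e (- u).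
Proof.
move=> Bsym Bind he [uB hu]; have [|heu|heu] := ltgtP (bilin B e u) 0.
- by left.
- by right; split; rewrite ?bilinNr ?bilinNl ?opprK // oppr_lt0.
- by case: uB; apply: index1_orthogonal_ker heu hu.
Qed.

Lemma cvg_bilin (T : Type) (F : set_system T) {FF : Filter F}
    (B_ : T -> 'M[R]_n) (u_ v_ : T -> 'rV[R]_n) B u v :
  B_ t @[t --> F] --> B -> u_ t @[t --> F] --> u -> v_ t @[t --> F] --> v ->
  bilin (B_ t) (u_ t) (v_ t) @[t --> F] --> bilin B u v.
Proof.
move=> hB hu hv.
have h : u_ t *m B_ t *m (v_ t)^T @[t --> F] --> u *m B *m v^T.
  by apply: cvg_mulmx; [exact: cvg_mulmx|exact: cvg_trmx].
exact: (cvg_mxP _ _).1 h 0 0.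
Qed.

(** The cone is star-shaped about [e], hence a union of segments sharing the point [e]. *)
Lemma connected_causal_cone B e : B^T = B -> bilin B e e < 0 ->
  connected (causal_cone B e).
Proof.
move=> Bsym he; pose seg u t : 'rV[R]_n := t *: e + (1 - t) *: u.
have -> : causal_cone B e =
    \bigcup_(u in causal_cone B e) (seg u @` `[0, 1]%classic).
  apply/seteqP; split=> [u hu|_ [u hu [t /= ht <-]]].
    exists u => //; exists 0; rewrite /= ?in_itv /= ?lexx ?ler01 //.
    by rewrite /seg scale0r add0r subr0 scale1r.
  by apply: causal_cone_star => //; move: ht; rewrite in_itv.
apply: bigcup_connected.
  exists e => u hu; exists 1; rewrite /= ?in_itv /= ?lexx ?ler01 //.
  by rewrite /seg subrr scale0r addr0 scale1r.
move=> u _; apply: connected_continuous_connected.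
  exact: segment_connected.
apply: continuous_subspaceT => t0.
have id0 : t @[t --> t0] --> t0 by exact: cvg_id.
apply: cvgD; apply: cvgZ => //; try exact: cvg_cst.
by apply: cvgB => //; exact: cvg_cst.
Qed.

Lemma causal_component B e u : B^T = B -> has_index B 1 -> bilin B e e < 0 ->
  causal_cone B e u -> connected_component (causal_set B) u = causal_cone B e.
Proof.
move=> Bsym Bind he hu; apply/seteqP; split; last first.
  apply: connected_component_max => //; first exact: causal_cone_sub.
  exact: connected_causal_cone.
move=> w [C [Cu CB Cconn] Cw]; split; first by have [] := CB _ Cw.
have cont : continuous (bilin B e).
  move=> x; have id0 : v @[v --> x] --> x by exact: cvg_id.
  exact: cvg_bilin (cvg_cst B) (cvg_cst e) id0.
(* On causal vectors [bilin B e] never vanishes, so the strict and the weak inequality cut out the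
   same part of [C], which is therefore both open and closed in [C]. *)
suff CE : C `&` [set v | bilin B e v < 0] = C by move: Cw; rewrite -CE => -[].
apply: Cconn; first by exists u; split=> //; case: hu.
- exists [set v | bilin B e v < 0] => //.
  by have := open_comp (fun x _ => cont x) (@open_lt _ (0 : R)).
exists [set v | bilin B e v <= 0].
  by have := closed_comp (fun x _ => cont x) (@closed_le _ (0 : R)).
apply/seteqP; split=> v [Cv hv]; split=> //; first exact: ltW.
rewrite /= lt_neqAle hv andbT; apply/eqP => hev.
by have [vB hvv] := CB _ Cv; apply: vB; exact: index1_orthogonal_ker hev hvv.
Qed.

Lemma causal_cone_incl B B1 e : B^T = B -> bilin B e e < 0 ->
  B1^T = B1 -> has_index B1 1 ->
  (forall u, u *m B <> 0 -> bilin B u u <= 0 ->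
     u *m B1 <> 0 /\ bilin B1 u u < 0) ->
  causal_cone B e `<=` causal_cone B1 e.
Proof.
move=> Bsym he B1sym B1ind lt u hu.
have sub w : causal_cone B e w -> w *m B1 <> 0 /\ bilin B1 w w < 0.
  by move=> /(causal_cone_sub Bsym)[]; exact: lt.
have [uB1 hu1] := sub u hu; have [_ he1] := sub e (causal_cone_self he).
split; first exact: ltW.
rewrite ltNge; apply/negP => heu.
have d0 : 0 < bilin B1 e u - bilin B1 e e by lra.
(* On the segment from [e] to [u] the form [B1 e] would vanish somewhere. *)
pose t := bilin B1 e u / (bilin B1 e u - bilin B1 e e).
have ht : 0 <= t <= 1.
  by rewrite divr_ge0 ?(ltW d0) //= ler_pdivrMr // mul1r; lra.
have [wB hw] := sub _ (causal_cone_star Bsym he hu ht).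
apply: wB; apply: index1_orthogonal_ker B1sym B1ind he1 _ (ltW hw).
by rewrite bilinDr !bilinZr /t; field; rewrite gt_eqF.
Qed.

End BilinAlgebra.

(** * Tangent vectors and tensors in charts *)

Section Charts.
Context {R : realType} {n : nat} (M : smooth_manifold R n).
Implicit Types (x : M) (phi psi chi : chart R n M).

Lemma chart_at_some x : chart_at x (some_chart x).
Proof. by rewrite /some_chart; case: cid2. Qed.

Lemma cimg_cmap phi x : cdom phi x -> cimg phi (cmap phi x).
Proof. by exists x. Qed.

Lemma cinv_cvg phi x : cdom phi x -> cinv phi z @[z --> cmap phi x] --> x.
Proof.
by move=> hx; rewrite -{2}(cmapK hx); exact: cinv_cont (cimg_cmap hx).
Qed.

Lemma near_cinv phi x (U : set M) : cdom phi x -> nbhs x U ->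
  \forall z \near cmap phi x, U (cinv phi z).
Proof. by move=> hx hU; exact: cinv_cvg hx _ hU. Qed.

Lemma near_cdom phi x : cdom phi x -> \forall y \near x, cdom phi y.
Proof. by move=> hx; apply: open_nbhs_nbhs; split=> //; exact: cdom_open. Qed.

Lemma near_cimg phi x : cdom phi x -> \forall z \near cmap phi x, cimg phi z.
Proof.
by move=> hx; apply: open_nbhs_nbhs; split; [exact: cimg_open|exact: cimg_cmap].
Qed.

Lemma cinvK phi z : cimg phi z -> cmap phi (cinv phi z) = z.
Proof. by move=> [x hx <-]; rewrite cmapK. Qed.

Lemma transition_differentiable x phi psi : chart_at x phi -> chart_at x psi ->
  differentiable (transition phi psi) (cmap phi x).
Proof.
move=> [aphi xphi] [apsi xpsi].
by have [/(_ 1) [h _] _] := atlas_compatible aphi apsi; apply: h; exists x.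
Qed.

Lemma transition_cmap x phi psi : cdom phi x ->
  transition phi psi (cmap phi x) = cmap psi x.
Proof. by move=> hx; rewrite /transition /= cmapK. Qed.

Lemma derive_transition x phi psi u : chart_at x phi -> chart_at x psi ->
  'D_u (transition phi psi) (cmap phi x)
  = u *m jacobian (transition phi psi) (cmap phi x).
Proof.
by move=> hphi hpsi; apply: deriveEjacobian; exact: transition_differentiable.
Qed.

(** Chain rule; the composite of two transitions agrees with the third one only near the point,
    which is enough for derivatives. *)
Lemma derive_transition_cocycle x phi psi chi u :
  chart_at x phi -> chart_at x psi -> chart_at x chi ->
  'D_('D_u (transition phi psi) (cmap phi x)) (transition psi chi) (cmap psi x)
  = 'D_u (transition phi chi) (cmap phi x).
Proof.
move=> hphi hpsi hchi.
have d1 := transition_differentiable hphi hpsi.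
have d2 := transition_differentiable hpsi hchi.
have xphi := hphi.2; have xpsi := hpsi.2.
rewrite -(transition_cmap psi xphi) in d2 *.
rewrite [RHS](@near_eq_derive _ _ _ _
  (transition psi chi \o transition phi psi)) //.
  rewrite [RHS]deriveE; last exact: differentiable_comp.
  by rewrite diff_comp // !deriveE.
apply: filterS (near_cinv xphi (near_cdom xpsi)) => z hz.
by rewrite /transition /= cmapK.
Qed.

Lemma derive_transition_id x phi u : chart_at x phi ->
  'D_u (transition phi phi) (cmap phi x) = u.
Proof.
move=> hphi; rewrite (@near_eq_derive _ _ _ _ id) //; first exact: derive_id.
apply: filterS (near_cimg hphi.2) => z hz.
by rewrite /transition /= cinvK.
Qed.

(** The other components are obtained by transporting [u] with the derivatives of the transitions;
    the cocycle rule gives [tlaw]. *)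
Lemma tangentP x phi u : chart_at x phi ->
  exists v : tangent M, tpt v = x /\ tcomp v phi = u.
Proof.
move=> hphi.
pose c psi := if pselect (chart_at x psi) is left _ then
  'D_u (transition phi psi) (cmap phi x) else 0.
have cE psi : chart_at x psi -> c psi = 'D_u (transition phi psi) (cmap phi x).
  by rewrite /c; case: pselect.
have c_out psi : ~ chart_at x psi -> c psi = 0 by rewrite /c; case: pselect.
have c_law psi chi : chart_at x psi -> chart_at x chi ->
    c chi = 'D_(c psi) (transition psi chi) (cmap psi x).
  by move=> hpsi hchi; rewrite !cE // derive_transition_cocycle.
exists (Tangent c_out c_law); split=> //=.
by rewrite cE // derive_transition_id.
Qed.

(** [tlaw] determines the components in the other charts at [x], and the default value 0 those in
    the remaining charts. *)
Lemma tangent_inj x phi (v w : tangent M) : chart_at x phi ->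
  tpt v = x -> tpt w = x -> tcomp v phi = tcomp w phi -> v = w.
Proof.
move=> + vx; rewrite -{}vx; case: v => x1 c c0 cl; case: w => y d d0 dl /=.
move=> + yx; case: x1 / yx in c0 cl * => hphi cd.
suff e : c = d.
  by case: d / e in d0 dl cd *; congr Tangent; exact: Prop_irrelevance.
apply: funext => psi; have [hpsi|hpsi] := pselect (chart_at y psi).
  by rewrite (cl _ _ hphi hpsi) (dl _ _ hphi hpsi) cd.
by rewrite c0 ?d0.
Qed.

Lemma scomp_transition x phi psi (b : symtensor M) : spt b = x ->
  chart_at x phi -> chart_at x psi ->
  forall u w, bilin (scomp b phi) u w =
    bilin (scomp b psi) (u *m jacobian (transition phi psi) (cmap phi x))
      (w *m jacobian (transition phi psi) (cmap phi x)).
Proof.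
by move=> <- hphi hpsi u w; rewrite (slaw hphi hpsi) !derive_transition.
Qed.

(** Frees [pairing] from the arbitrary choice of [some_chart]. *)
Lemma pairingE (g : symfield M) (v w : tangent M) phi :
  tpt w = tpt v -> chart_at (tpt v) phi ->
  pairing g v w = bilin (scomp (g (tpt v)) phi) (tcomp v phi) (tcomp w phi).
Proof.
move=> wv hphi; have h0 := chart_at_some (tpt v).
have hs := sf_pt g (tpt v).
rewrite /pairing (tlaw hphi h0) (@tlaw _ _ _ w phi) ?wv //.
by rewrite [RHS](@slaw _ _ _ _ phi (some_chart (tpt v))) hs.
Qed.

End Charts.

(** * The vertical space as the common kernel of transverse metrics *)

Section TransverseMetrics.
Context {R : realType} {n : nat} {M : smooth_manifold R n} {q : nat}.
Variable F : foliation M q.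
Implicit Types (x : M) (phi psi : chart R n M) (g h : symfield M).

(** [A] is the Jacobian at [x] of the local submersion, and the rows of [W] lift the standard basis
    through it, so they span a complement of the vertical space. *)
Lemma vertical_matrix x phi : chart_at x phi ->
  exists (A : 'M[R]_(n, q)) (W : 'M[R]_(q, n)), W *m A = 1%:M /\
    forall v, tpt v = x -> (vertical F v <-> tcomp v phi *m A = 0).
Proof.
move=> hphi; pose phi0 := some_chart x; have h0 := chart_at_some x.
pose s := fol_sub F x; have [smooth surj] := fol_submersion F x.
have sdiff : differentiable (s \o cinv phi0) (cmap phi0 x).
  have [sd _] := smooth _ h0.1 1%N; apply: sd.
  by exists x => //; split; [exact: h0.2|exact: fol_dom_refl].
pose A := jacobian (transition phi phi0) (cmap phi x) *m
  jacobian (s \o cinv phi0) (cmap phi0 x).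
have dE v : tpt v = x -> differential_at s v = tcomp v phi *m A.
  move=> vx; rewrite /differential_at vx (@tlaw _ _ _ v phi) ?vx //.
  by rewrite deriveEjacobian // derive_transition // mulmxA.
have /choice[t tE] : forall j : 'I_q, exists v : tangent M,
    tpt v = x /\ differential_at s v = delta_mx 0 j.
  by move=> j; have [v] := surj x (fol_dom_refl F x) (delta_mx 0 j); exists v.
exists A, (\matrix_j tcomp (t j) phi); split.
  by apply/row_matrixP => j; rewrite row_mul rowK -dE ?row1; case: (tE j).
by move=> v vx; rewrite /vertical vx dE.
Qed.

Lemma verticalP g v phi : transverse_lorentzian F g -> chart_at (tpt v) phi ->
  vertical F v <-> tcomp v phi *m scomp (g (tpt v)) phi = 0.
Proof.
move=> [_ _ hker] hphi; rewrite hker; split=> [hv|hv w wv]; last first.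
  by rewrite (pairingE g wv hphi) bilin0l.
apply: bilin_nondeg => u; have [w [wv <-]] := tangentP u hphi.
by rewrite -(pairingE g wv hphi) hv.
Qed.

(** [A] and [W] are chosen before [g]: one complement then serves to compare two metrics. *)
Lemma transverse_kernel x phi : chart_at x phi ->
  exists (A : 'M[R]_(n, q)) (W : 'M[R]_(q, n)), W *m A = 1%:M /\
    forall g, transverse_lorentzian F g ->
    forall u : 'rV_n, u *m scomp (g x) phi = 0 <-> u *m A = 0.
Proof.
move=> hphi; have [A [W [WA hA]]] := vertical_matrix hphi.
exists A, W; split=> // g hg u; have [v [vx <-]] := tangentP u hphi.
by rewrite -(hA v vx) -[in X in X <-> _]vx -verticalP ?vx.
Qed.

Lemma comps_at_causal g x phi : transverse_lorentzian F g -> chart_at x phi ->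
  comps_at (trans_causal F g) x phi = causal_set (scomp (g x) phi).
Proof.
move=> hg hphi; apply/seteqP; split=> [_ [v [vx [nv hv]] <-]|u [uG hu]].
  move: hphi nv hv; rewrite -vx => hphi.
  by rewrite (verticalP hg hphi) (pairingE g erefl hphi).
have [v [vx vu]] := tangentP u hphi; exists v => //; split=> //.
move: hphi uG hu; rewrite -vu -{}vx => hphi uG hu; split.
  by rewrite (verticalP hg hphi).
by rewrite (pairingE g erefl hphi).
Qed.

Lemma metric_lt_chart g h x phi : transverse_lorentzian F g ->
  transverse_lorentzian F h -> chart_at x phi ->
  metric_lt F g h -> forall u : 'rV_n, u *m scomp (g x) phi <> 0 ->
  bilin (scomp (g x) phi) u u <= 0 ->
  u *m scomp (h x) phi <> 0 /\ bilin (scomp (h x) phi) u u < 0.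
Proof.
move=> hg hh hphi lt u; have [v [vx <-]] := tangentP u hphi.
move: hphi; rewrite -vx => hphi.
rewrite -(verticalP hg hphi) -(verticalP hh hphi).
rewrite -!(pairingE _ erefl hphi) => nv hv; split=> //; exact: lt.
Qed.

End TransverseMetrics.

(** * Openness of the comparison of two forms on a complement *)

Section DominatedForms.
Context {R : realType} {n q : nat}.
Implicit Types (B : 'M[R]_n) (W : 'M[R]_(q, n)).

(* The row space of W stands for a complement of the vertical space. *)
Definition dominated_on B1 B W : Prop :=
  forall c : 'rV[R]_q, c != 0 -> c *m W *m B1 != 0 /\
    (0 < bilin B (c *m W) (c *m W) \/ bilin B1 (c *m W) (c *m W) < 0).

(** The conditions on [c] are invariant under multiplication of [c] by a positive number. *)
Lemma dominated_on_sphere B1 B W :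
  (forall c : 'rV[R]_q, `|c| = 1 -> c *m W *m B1 != 0 /\
    (0 < bilin B (c *m W) (c *m W) \/ bilin B1 (c *m W) (c *m W) < 0)) ->
  dominated_on B1 B W.
Proof.
move=> h c c0; pose k := `|c|.
have k0 : 0 < k by rewrite normr_gt0.
have [] := h (k^-1 *: c).
  by rewrite normrZ ger0_norm ?invr_ge0 ?ltW // mulVf // gt_eqF.
rewrite -!scalemxAl !(bilinZl, bilinZr) scaler_eq0 invr_eq0 gt_eqF //= => ? h2.
by split=> //; move: h2; rewrite !(pmulr_rgt0, pmulr_rlt0) ?invr_gt0.
Qed.

Lemma compact_sphere : compact [set c : 'rV[R]_q | `|c| = 1].
Proof.
apply: bounded_closed_compact.
  by exists 1; split=> // r r1 c /= ->; exact: ltW.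
by have := closed_comp (fun c _ => @norm_continuous R 'rV[R]_q c)
  (@closed_eq R 1).
Qed.

(** For each [c] the conditions are strict, hence open jointly in [c] and the two forms. Compactness
    of the sphere gives a neighborhood of the pair of forms that is uniform in [c]. *)
Lemma near_dominated_on B1 B W : dominated_on B1 B W ->
  \forall p \near (B1, B), dominated_on p.1 p.2 W.
Proof.
move=> dom; have /compact_near_coveringP cover := compact_sphere.
pose P (p : 'M[R]_n * 'M[R]_n) (c : 'rV[R]_q) := c *m W *m p.1 != 0 /\
    (0 < bilin p.2 (c *m W) (c *m W) \/ bilin p.1 (c *m W) (c *m W) < 0).
suff : \forall p \near (B1, B), [set c : 'rV[R]_q | `|c| = 1] `<=` P p.
  by apply: filterS => p hp; exact: dominated_on_sphere.
apply: (cover _ (nbhs (B1, B)) P) => c /= c1.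
have c0 : c != 0 by rewrite -normr_eq0 c1 oner_eq0.
have [cB hc] := dom c c0.
have cvgB1 : z.2.1 @[z --> (c, (B1, B))] --> B1.
  exact: (cvg_comp _ _ cvg_snd cvg_fst).
have cvgB : z.2.2 @[z --> (c, (B1, B))] --> B.
  exact: (cvg_comp _ _ cvg_snd cvg_snd).
have cvgc : z.1 *m W @[z --> (c, (B1, B))] --> c *m W.
  by apply: cvg_mulmx; [exact: cvg_fst|exact: cvg_cst].
suff : \forall z \near (c, (B1, B)), P z.2 z.1 by [].
apply: filterI.
  have : z.1 *m W *m z.2.1 @[z --> (c, (B1, B))] --> c *m W *m B1.
    exact: cvg_mulmx.
  by move=> /cvgr_neq0; exact.
case: hc => hc; [apply: filterS (fun=> @or_introl _ _) _|
  apply: filterS (fun=> @or_intror _ _) _].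
- exact: cvgr_gt (cvg_bilin cvgB cvgc cvgc) _ hc.
- exact: cvgr_lt (cvg_bilin cvgB1 cvgc cvgc) _ hc.
Qed.

End DominatedForms.

(** * The open set of tensors whose causal vectors are timelike for [g1] *)

Section Neighborhood.
Context {R : realType} {n : nat} {M : smooth_manifold R n} {q : nat}.
Variable F : foliation M q.
Implicit Types (x : M) (phi psi : chart R n M) (g h : symfield M).

(** Openness in the bundle concerns all tensors, including those whose kernel is not vertical.
    Testing [b] only on some complement [W] gives a condition that survives small perturbations in
    every direction. *)
Definition below (g1 : symfield M) : set (symtensor M) :=
  [set b | forall phi, chart_at (spt b) phi -> exists W : 'M[R]_(q, n),
    dominated_on (scomp (g1 (spt b)) phi) (scomp b phi) W].

(** The Jacobian carries [W] to the other chart and preserves the values of both forms, so one chart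
    suffices to test [below]. *)
Lemma dominated_on_transition (g1 : symfield M) (b : symtensor M) phi psi
    (W : 'M[R]_(q, n)) :
  chart_at (spt b) phi -> chart_at (spt b) psi ->
  dominated_on (scomp (g1 (spt b)) phi) (scomp b phi) W ->
  dominated_on (scomp (g1 (spt b)) psi) (scomp b psi)
    (W *m jacobian (transition phi psi) (cmap phi (spt b))).
Proof.
move=> hphi hpsi dom c /dom[cB].
set J := jacobian _ _; set x := spt b in hphi hpsi J *.
have g1E := scomp_transition (sf_pt g1 x) hphi hpsi.
rewrite (scomp_transition erefl hphi hpsi) g1E -/J !mulmxA; split=> //.
apply: contra_neq cB => cJ; apply: bilin_nondeg => w.
by rewrite g1E bilin0l.
Qed.

Lemma cvg_scomp g phi y : atlas phi -> cimg phi y ->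
  scomp (g (cinv phi z)) phi @[z --> y] --> scomp (g (cinv phi y)) phi.
Proof. by move=> aphi; move: y; exact: (sf_smooth g aphi 0%N). Qed.

Lemma open_below g1 : open_in_bundle (below g1).
Proof.
move=> phi aphi.
(* The first conjunct keeps [p.1] where [cinv phi] is a true inverse. A [W] that works at one point
   works nearby, because [g1] is continuous in the chart. *)
exists [set p | cimg phi p.1 /\ exists W : 'M[R]_(q, n),
    dominated_on (scomp (g1 (cinv phi p.1)) phi) p.2 W].
  rewrite openE => -[y B] [/= hy [W dom]].
  have near1 : \forall p \near (y, B), cimg phi p.1.
    have : nbhs y (cimg phi).
      by apply: open_nbhs_nbhs; split=> //; exact: cimg_open.
    exact: cvg_fst.
  have cvgG : scomp (g1 (cinv phi p.1)) phi @[p --> (y, B)]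
      --> scomp (g1 (cinv phi y)) phi.
    apply: (cvg_comp fst (fun z => scomp (g1 (cinv phi z)) phi)).
      exact: cvg_fst.
    exact: cvg_scomp.
  have cvgS : p.2 @[p --> (y, B)] --> B by exact: cvg_snd.
  have near2 : \forall p \near (y, B),
      dominated_on (scomp (g1 (cinv phi p.1)) phi) p.2 W.
    exact: cvg_pair cvgG cvgS _ (near_dominated_on dom).
  apply: filterS (filterI near1 near2) => p [hp1 hp2].
  by split=> //; exists W.
move=> b hb; have hphi : chart_at (spt b) phi by [].
split=> [/(_ phi hphi)[W dom]|[/= _]].
  by split=> /=; [exact: cimg_cmap|exists W; rewrite cmapK].
rewrite cmapK // => -[W dom] psi hpsi.
by eexists; exact: dominated_on_transition dom.
Qed.

(** With [W] a complement of the vertical space, a nonzero [c *m W] is nonvertical, so it is either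
    spacelike for [g] or, by [g < g1], timelike for [g1]. *)
Lemma metric_lt_below g g1 x : transverse_lorentzian F g ->
  transverse_lorentzian F g1 -> metric_lt F g g1 -> below g1 (g x).
Proof.
move=> hg hg1 lt phi; rewrite sf_pt => hphi.
have [A [W [WA ker]]] := transverse_kernel F hphi.
exists W => c c0.
have cG g' : transverse_lorentzian F g' -> c *m W *m scomp (g' x) phi <> 0.
  by move=> hg' /(ker g' hg'); rewrite -mulmxA WA mulmx1; exact/eqP.
split; first by apply/eqP; exact: cG.
have [|hc] := ltP 0 (bilin (scomp (g x) phi) (c *m W) (c *m W)); first by left.
by right; have [] := metric_lt_chart hg hg1 hphi lt (cG g hg) hc.
Qed.

(** Domination forces the row space of [W] to be a complement of the vertical space, and both
    metrics ignore vertical components, so testing on [W] tests every vector. *)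
Lemma below_metric_lt h g1 : transverse_lorentzian F h ->
  transverse_lorentzian F g1 -> (forall x, below g1 (h x)) -> metric_lt F h g1.
Proof.
move=> hh hg1 hb v; set x := tpt v; pose phi := some_chart x.
have hphi : chart_at x phi := chart_at_some x.
have := hb x phi; rewrite sf_pt => /(_ hphi)[W dom].
have [A [_ [_ ker]]] := transverse_kernel F hphi.
rewrite (verticalP hh hphi) !(pairingE _ erefl hphi) -/x.
set u := tcomp v phi; have unitWA : W *m A \in unitmx.
  rewrite -row_free_unit; apply: inj_row_free => c; rewrite mulmxA.
  move=> /(ker g1 hg1) cG; apply/eqP/negPn/negP => /dom[].
  by rewrite cG eqxx.
have [c [k [uE kA]]] : exists c k, u = c *m W + k /\ k *m A = 0.
  (* The solution of [c *m W *m A = u *m A], which makes the remainder vertical. *)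
  pose c := u *m A *m invmx (W *m A); exists c, (u - c *m W).
  by rewrite addrC subrK mulmxBl -[c *m W *m A]mulmxA mulmxKV // subrr.
have bE g' : transverse_lorentzian F g' -> bilin (scomp (g' x) phi) u u =
    bilin (scomp (g' x) phi) (c *m W) (c *m W).
  move=> hg'; have kG := (ker g' hg' k).2 kA.
  rewrite uE !(bilinDl, bilinDr) (bilinC (c *m W) k (scomp_sym _ _)).
  by rewrite !(bilin0l _ kG) !addr0.
rewrite !bE // => uH hc; have [c0|/dom[_ []//]] := eqVneq c 0.
  by case: uH; rewrite uE c0 mul0mx add0r; exact/(ker h hh).
by rewrite ltNge hc.
Qed.

End Neighborhood.

(** * Negation of tangent vectors *)

Section OppositeTangent.
Context {R : realType} {n : nat} {M : smooth_manifold R n}.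
Implicit Type v : tangent M.

Fact opp_tangent_out v phi : ~ chart_at (tpt v) phi -> - tcomp v phi = 0.
Proof. by move=> /tcomp_out ->; rewrite oppr0. Qed.

Fact opp_tangent_law v phi psi : chart_at (tpt v) phi -> chart_at (tpt v) psi ->
  - tcomp v psi = 'D_(- tcomp v phi) (transition phi psi) (cmap phi (tpt v)).
Proof.
move=> hphi hpsi.
by rewrite (tlaw hphi hpsi) !derive_transition // mulNmx.
Qed.

Definition opp_tangent v : tangent M :=
  Tangent (@opp_tangent_out v) (@opp_tangent_law v).

End OppositeTangent.

(** * Time orientations of comparable metrics *)

Section TimeOrientations.
Context {R : realType} {n : nat} {M : smooth_manifold R n} {q : nat}.
Variable F : foliation M q.
Implicit Types (x y : M) (phi psi : chart R n M) (g h : symfield M).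
Implicit Types (T : set (tangent M)).

Lemma comps_atP T v phi : chart_at (tpt v) phi ->
  comps_at T (tpt v) phi (tcomp v phi) <-> T v.
Proof.
move=> hphi; split=> [[w [wv Tw] wvE]|Tv]; last by exists v.
by rewrite (tangent_inj hphi erefl wv (esym wvE)).
Qed.

Lemma transverse_index1 g x phi : transverse_lorentzian F g ->
  chart_at x phi -> has_index (scomp (g x) phi) 1.
Proof. by move=> [_ h _]; exact: h. Qed.

Lemma orientation_fiber g T x phi e : transverse_lorentzian F g ->
  time_orientation F g T -> chart_at x phi -> bilin (scomp (g x) phi) e e < 0 ->
  comps_at T x phi = causal_cone (scomp (g x) phi) e \/
  comps_at T x phi = causal_cone (scomp (g x) phi) (- e).
Proof.
move=> hg [hT _] hphi he; have [u + ->] := hT x phi hphi.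
rewrite comps_at_causal // => hu; have Bsym := scomp_sym (g x) phi.
have Bind := transverse_index1 hg hphi.
have [hc|hc] := causal_set_cone Bsym Bind he hu; [left|right].
  exact: causal_component.
apply: causal_component => //; first by rewrite bilinNl bilinNr opprK.
by case: hc; rewrite !bilinNr bilinNl opprK => ? ?; split; rewrite ?bilinNl.
Qed.

Lemma orientation_cone g T x phi e : transverse_lorentzian F g ->
  time_orientation F g T -> chart_at x phi -> bilin (scomp (g x) phi) e e < 0 ->
  comps_at T x phi e -> comps_at T x phi = causal_cone (scomp (g x) phi) e.
Proof.
move=> hg hT hphi he; case: (orientation_fiber hg hT hphi he) => -> // [_].
by rewrite bilinNl oppr_lt0 ltNge (ltW he).
Qed.

Lemma cvg_scomp_pt g phi x : chart_at x phi ->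
  scomp (g y) phi @[y --> x] --> scomp (g x) phi.
Proof.
move=> [aphi xphi].
have c1 : scomp (g (cinv phi (cmap phi y))) phi @[y --> x]
    --> scomp (g (cinv phi (cmap phi x))) phi.
  apply: (cvg_comp (cmap phi) (fun z => scomp (g (cinv phi z)) phi)).
    exact: cmap_cont.
  exact: cvg_scomp aphi (cimg_cmap xphi).
rewrite (cmapK xphi) in c1; apply: cvg_trans c1; apply: near_eq_cvg.
by apply: filterS (near_cdom xphi) => y hy /=; rewrite cmapK.
Qed.

Lemma near_timelike g phi x e : chart_at x phi ->
  bilin (scomp (g x) phi) e e < 0 ->
  \forall y \near x, bilin (scomp (g y) phi) e e < 0.
Proof.
move=> hphi he.
have c : bilin (scomp (g y) phi) e e @[y --> x] --> bilin (scomp (g x) phi) e e.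
  exact: cvg_bilin (cvg_scomp_pt (g := g) hphi) (cvg_cst e) (cvg_cst e).
exact: cvgr_lt c _ he.
Qed.

(** The local continuous field [X] in [T] satisfies [bilin e X < 0] at [x], hence nearby; this
    prevents the fiber of [T] from switching to the cone of [- e]. *)
Lemma near_orientation g T x phi e : transverse_lorentzian F g ->
  time_orientation F g T -> chart_at x phi -> bilin (scomp (g x) phi) e e < 0 ->
  comps_at T x phi e -> \forall y \near x, comps_at T y phi e.
Proof.
move=> hg hT hphi he hx; have [_ /(_ x phi hphi)[U [X]]] := hT.
move=> [oU Ux Uphi Xcont XT].
have nearU : \forall y \near x, U y by exact: open_nbhs_nbhs.
have heX : bilin (scomp (g x) phi) e (X (cmap phi x)) < 0.
  by have := XT x Ux; rewrite (orientation_cone hg hT hphi he hx) => -[].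
have cvgX : X (cmap phi y) @[y --> x] --> X (cmap phi x).
  apply: (cvg_comp (cmap phi) X); last exact: Xcont.
  exact: cmap_cont hphi.2.
have near2 : \forall y \near x, bilin (scomp (g y) phi) e (X (cmap phi y)) < 0.
  have c : bilin (scomp (g y) phi) e (X (cmap phi y)) @[y --> x]
      --> bilin (scomp (g x) phi) e (X (cmap phi x)).
    exact: cvg_bilin (cvg_scomp_pt (g := g) hphi) (cvg_cst e) cvgX.
  exact: cvgr_lt c _ heX.
apply: filterS (filterI nearU (filterI near2 (near_timelike hphi he))).
move=> y [Uy [heXy hey]].
have hphiy : chart_at y phi by split; [exact: hphi.1|exact: Uphi].
have := XT y Uy; case: (orientation_fiber hg hT hphiy hey) => ->.
  by move=> _; exact: causal_cone_self.
by move=> [_]; rewrite bilinNl oppr_lt0 ltNge (ltW heXy).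
Qed.

Section Comparison.
Variables (g1 h : symfield M) (T1 : set (tangent M)).
Hypotheses (hg1 : transverse_lorentzian F g1) (hh : transverse_lorentzian F h)
  (hT1 : time_orientation F g1 T1) (lt : metric_lt F h g1).

Lemma timelike_lt x phi e : chart_at x phi ->
  bilin (scomp (h x) phi) e e < 0 -> bilin (scomp (g1 x) phi) e e < 0.
Proof.
move=> hphi he.
have [|_ //] := metric_lt_chart hh hg1 hphi lt (u := e) _ (ltW he).
by move=> eH; move: he; rewrite (bilin0l _ eH) ltxx.
Qed.

Lemma causal_cone_lt x phi e : chart_at x phi ->
  bilin (scomp (h x) phi) e e < 0 ->
  causal_cone (scomp (h x) phi) e `<=` causal_cone (scomp (g1 x) phi) e.
Proof.
move=> hphi he; apply: causal_cone_incl => //; try exact: scomp_sym.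
  exact: transverse_index1 hg1 hphi.
exact: metric_lt_chart hh hg1 hphi lt.
Qed.

Lemma timelike_in_orientation x phi : chart_at x phi ->
  exists2 e, bilin (scomp (h x) phi) e e < 0 & comps_at T1 x phi e.
Proof.
move=> hphi; have [e he] := index1_exists (transverse_index1 hh hphi).
have he1 := timelike_lt hphi he.
have [E|E] := orientation_fiber hg1 hT1 hphi he1.
  by exists e => //; rewrite E; exact: causal_cone_self.
exists (- e); first by rewrite bilinNl bilinNr opprK.
by rewrite E; apply: causal_cone_self; rewrite bilinNl bilinNr opprK.
Qed.

(** For an [h]-timelike [e] in [T1], the fiber is the [h]-cone of [e], because the cones of [e] and
    [- e] for [h] lie in the corresponding cones for [g1]. The constant coordinate field [e] gives
    continuity. *)
Lemma time_orientation_lt : time_orientation F h (trans_causal F h `&` T1).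
Proof.
have compsE x phi : chart_at x phi ->
    comps_at (trans_causal F h `&` T1) x phi =
    causal_set (scomp (h x) phi) `&` comps_at T1 x phi.
  move=> hphi; rewrite -(comps_at_causal hh hphi); apply/seteqP; split=> u.
    by move=> [v [vx [cv Tv]] vu]; split; exists v.
  move=> [[v [vx cv] <-] [w [wx Tw] wv]].
  by exists v => //; split=> //; split=> //; rewrite (tangent_inj hphi vx wx).
split=> x phi hphi; have [e he eT1] := timelike_in_orientation hphi;
  have he1 := timelike_lt hphi he.
- have Hsym := scomp_sym (h x) phi.
  have eC : causal_set (scomp (h x) phi) e.
    by apply: (causal_cone_sub (e := e)) => //; exact: causal_cone_self.
  have Hind := transverse_index1 hh hphi.
  exists e; rewrite ?compsE ?comps_at_causal //.
  rewrite (causal_component Hsym Hind he (causal_cone_self he)).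
  rewrite (orientation_cone hg1 hT1 hphi he1 eT1).
  apply/seteqP; split=> [u [uC [_ heu1]]|u hu]; last first.
    by split; [exact: causal_cone_sub hu|exact: causal_cone_lt].
  have [//|/(causal_cone_lt hphi he)[_]] := causal_set_cone Hsym Hind he uC.
  by rewrite bilinNr oppr_lt0 ltNge (ltW heu1).
(* The points where the constant field [e] is a valid local section; its interior supplies the
   required open set. *)
- pose N := [set y | [/\ cdom phi y, bilin (scomp (h y) phi) e e < 0 &
    comps_at T1 y phi e]].
  have nbhsN : nbhs x N.
    apply: filterS (filterI (near_cdom hphi.2) (filterI (near_timelike hphi he)
      (near_orientation hg1 hT1 hphi he1 eT1))).
    by move=> y [? []].
  pose U := interior N; have UP := @interior_subset _ N.
  have oU : open U := open_interior N; have Ux : U x := nbhsN.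
  exists U, (fun=> e); split=> //; first by move=> y /UP[].
    by move=> y _; exact: cst_continuous.
  move=> y /UP[yphi [hey eT1y]].
  have hphiy : chart_at y phi by split; [exact: hphi.1|].
  rewrite compsE //; split=> //; apply: (causal_cone_sub (e := e)) => //.
    exact: scomp_sym.
  exact: causal_cone_self.
Qed.

(** The points where [T] agrees with [T1] and those where it is opposite form two disjoint open sets
    covering [M]. *)
Lemma orientation_dichotomy T : connected [set: M] -> time_orientation F h T ->
  T `<=` T1 \/ forall v, T v -> T1 (opp_tangent v).
Proof.
move=> hM hT.
pose S := [set x | forall v, tpt v = x -> T v -> T1 v].
pose S' := [set x | forall v, tpt v = x -> T v -> T1 (opp_tangent v)].
(* A single [h]-timelike vector common to both fibers decides for the whole fiber of [T], by
   inclusion of cones. *)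
have memS x phi e : chart_at x phi -> bilin (scomp (h x) phi) e e < 0 ->
    comps_at T x phi e -> comps_at T1 x phi e -> S x.
  move=> + + + + v vx; rewrite -{}vx => hphi he eT eT1.
  rewrite -!(comps_atP _ hphi) (orientation_cone hh hT hphi he eT).
  rewrite (orientation_cone hg1 hT1 hphi (timelike_lt hphi he) eT1).
  exact: causal_cone_lt.
have memS' x phi e : chart_at x phi -> bilin (scomp (h x) phi) e e < 0 ->
    comps_at T x phi e -> comps_at T1 x phi (- e) -> S' x.
  move=> + + + + v vx; rewrite -{}vx => hphi he eT eT1.
  have heN : bilin (scomp (h (tpt v)) phi) (- e) (- e) < 0.
    by rewrite bilinNl bilinNr opprK.
  rewrite -(comps_atP T hphi) -(comps_atP (v := opp_tangent v) T1 hphi) /=.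
  rewrite (orientation_cone hh hT hphi he eT).
  rewrite (orientation_cone hg1 hT1 hphi (timelike_lt hphi heN) eT1).
  move=> [hv hev]; apply: causal_cone_lt => //.
  by split; rewrite bilinNl bilinNr opprK.
have near_SS' x : nbhs x S \/ nbhs x S'.
  pose phi := some_chart x; have hphi : chart_at x phi := chart_at_some x.
  have [e0 he0 _] := timelike_in_orientation hphi.
  have [e [he eT]] : exists e, bilin (scomp (h x) phi) e e < 0 /\
      comps_at T x phi e.
    have he0N : bilin (scomp (h x) phi) (- e0) (- e0) < 0.
      by rewrite bilinNl bilinNr opprK.
    by have [E|E] := orientation_fiber hh hT hphi he0;
      [exists e0|exists (- e0)]; rewrite E; split=> //;
      exact: causal_cone_self.
  have he1 := timelike_lt hphi he.
  have near_e : \forall y \near x, [/\ chart_at y phi,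
      bilin (scomp (h y) phi) e e < 0 & comps_at T y phi e].
    apply: filterS (filterI (near_cdom hphi.2) (filterI (near_timelike hphi he)
      (near_orientation hh hT hphi he eT))).
    by move=> y [yphi [? ?]]; split=> //; split=> //; exact: hphi.1.
  have [E|E] := orientation_fiber hg1 hT1 hphi he1; [left|right].
    have eT1 : comps_at T1 x phi e by rewrite E; exact: causal_cone_self.
    apply: filterS (filterI near_e (near_orientation hg1 hT1 hphi he1 eT1)).
    by move=> y [[yphi hey eTy] eT1y]; exact: (memS y phi e).
  have he1N : bilin (scomp (g1 x) phi) (- e) (- e) < 0.
    by rewrite bilinNl bilinNr opprK.
  have eT1 : comps_at T1 x phi (- e) by rewrite E; exact: causal_cone_self.
  apply: filterS (filterI near_e (near_orientation hg1 hT1 hphi he1N eT1)).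
  by move=> y [[yphi hey eTy] eT1y]; exact: (memS' y phi e).
have disj x : S x -> ~ S' x.
  pose phi := some_chart x; have hphi : chart_at x phi := chart_at_some x.
  have [e he eT1] := timelike_in_orientation hphi.
  (* Over an empty fiber both [S] and [S'] would hold vacuously, so an actual vector of [T] is
     produced. *)
  have [v [vx Tv]] : exists v, tpt v = x /\ T v.
    have [u uC TE] := hT.1 x phi hphi.
    have : comps_at T x phi u.
      by rewrite TE; exact: connected_component_refl.
    by move=> [w [wx Tw] _]; exists w.
  move: hphi he eT1; rewrite -vx => hphi he eT1 Sx S'x.
  have := Sx v erefl Tv; have := S'x v erefl Tv.
  rewrite -(comps_atP T1 hphi) -(comps_atP (v := opp_tangent v) T1 hphi) /=.
  rewrite (orientation_cone hg1 hT1 hphi (timelike_lt hphi he) eT1).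
  by move=> [_]; rewrite bilinNr oppr_lt0 => h1 [_]; rewrite ltNge (ltW h1).
have S'E : S' = ~` S.
  apply/seteqP; split=> x; first by move=> S'x /disj.
  by case: (near_SS' x) => /(@nbhs_singleton _ x).
have oS : open S.
  rewrite openE => x Sx; case: (near_SS' x) => // /(@nbhs_singleton _ x).
  by move/(disj _ Sx).
have oS' : open S'.
  rewrite openE => x S'x; case: (near_SS' x) => // /(@nbhs_singleton _ x).
  by move=> /disj.
have [S0|/nonemptyPn S0] := pselect (S !=set0).
  left=> v; suff : S (tpt v) by apply.
  suff -> : S = setT by [].
  apply: hM => //; first by exists S; rewrite ?setTI.
  exists S; rewrite ?setTI // -[S]setCK -S'E; exact: open_closedC.
right=> v; suff : S' (tpt v) by apply.
by rewrite S'E S0.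
Qed.

End Comparison.
End TimeOrientations.

(** * Reversal of the parameter of a curve *)

Section CurveReversal.
Context {R : realType}.

(** The two difference quotients are the same function, so the identity holds at every point without
    differentiability and can be used under [funext]. *)
Lemma derive_comp_opp (V W : normedModType R) (f : V -> W) (v x : V) :
  'D_v (fun y => f (- y)) x = 'D_(- v) f (- x).
Proof.
rewrite /derive; set g1 := (X in fmap X); set g2 := (X in _ = lim (fmap X _)).
suff -> : g1 = g2 by [].
by apply/funext => t; rewrite /g1 /g2 /= opprD scalerN.
Qed.

Lemma Ck_on_comp_opp (V W : normedModType R) k (U : set V) (f : V -> W) :
  Ck_on k U f -> Ck_on k [set x | U (- x)] (fun x => f (- x)).
Proof.
have cont_opp (x : V) : {for x, continuous (fun y : V => - y)}.
  exact: opp_continuous.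
elim: k f => [|k IH] f /=.
  by move=> fc x Ux; exact: (continuous_comp (g := f) (cont_opp x) (fc _ Ux)).
move=> [df Df]; split=> [x Ux|v].
  by apply: (@differentiable_comp _ _ _ _ (fun y : V => - y)) => //; exact: df.
rewrite (_ : (fun x => _) = (fun x => 'D_(- v) f (- x))); last first.
  by apply/funext => x; exact: derive_comp_opp.
exact: (IH (fun y => 'D_(- v) f y) (Df (- v))).
Qed.

Context {n : nat} {M : smooth_manifold R n}.
Implicit Types (c d : R -> M) (a b t : R) (phi : chart R n M).

Lemma smooth_curve_opp a b c : smooth_curve_on a b c ->
  smooth_curve_on (- b) (- a) (fun t => c (- t)).
Proof.
have itvN t : - b < t < - a = (a < - t < b).
  by rewrite ltrNl ltrNr andbC.
move=> [cc cs]; split=> [t|phi aphi k].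
  rewrite itvN => ht.
  have copp : {for t, continuous (fun s : R => - s)} by exact: opp_continuous.
  exact: (continuous_comp (g := c) copp (cc _ ht)).
have := Ck_on_comp_opp (cs phi aphi k); congr Ck_on.
by apply: eq_set => t /=; rewrite itvN.
Qed.

(** Smoothness enters because a directional derivative is odd in the direction only where the map is
    differentiable. *)
Lemma velocity_opp a b d t v : smooth_curve_on a b d -> a < t < b ->
  velocity d t v -> velocity (fun s => d (- s)) (- t) (opp_tangent v).
Proof.
move=> [_ ds] ht [vt vE]; split=> /=; rewrite opprK // => phi hphi.
have [/(_ t) dd _] := ds phi hphi.1 1%N.
rewrite vE // !derive1E (derive_comp_opp (cmap phi \o d)) opprK.
have {}dd : differentiable (cmap phi \o d) t.
  by apply: dd; split=> //; exact: hphi.2.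
by rewrite [X in - X = _]deriveE // [RHS]deriveE // linearN.
Qed.

End CurveReversal.

(** * Transfer of causal curves from [h] to [g1] *)

Section CausalCurves.
Context {R : realType} {n : nat} {M : smooth_manifold R n} {q : nat}.
Variable F : foliation M q.
Variables (g1 h : symfield M) (T1 T : set (tangent M)).
Hypotheses (hg1 : transverse_lorentzian F g1) (lt : metric_lt F h g1).

Lemma trans_causal_lt v : trans_causal F h v -> trans_causal F g1 v.
Proof. by move=> [nv hv]; split=> //; exact/ltW/lt. Qed.

Lemma trans_causal_opp v : trans_causal F g1 v ->
  trans_causal F g1 (opp_tangent v).
Proof.
have hphi := chart_at_some (tpt v).
rewrite /trans_causal !(verticalP hg1 (phi := some_chart (tpt v))) //=.
move=> [nv hv]; split; last by rewrite /pairing /= bilinNl bilinNr opprK.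
by rewrite mulNmx => /eqP; rewrite oppr_eq0 => /eqP.
Qed.

Lemma future_causal_curve_sub c a b : T `<=` T1 ->
  future_causal_curve F h T c a b -> future_causal_curve F g1 T1 c a b.
Proof.
move=> TT1 [ts path_ts pieces]; exists ts => // i hi.
have [d [a' [b' [aa' bb' smooth_d hd]]]] := pieces i hi.
exists d, a', b'; split=> // t /hd[dc [v [vel cv Tv]]].
by split=> //; exists v; split=> //; [exact: trans_causal_lt|exact: TT1].
Qed.

Lemma future_causal_piece_opp c a b : (forall v, T v -> T1 (opp_tangent v)) ->
  future_causal_piece F h T c a b ->
  future_causal_piece F g1 T1 (fun t => c (- t)) (- b) (- a).
Proof.
move=> TT1 [d [a' [b' [aa' bb' smooth_d hd]]]].
exists (fun t => d (- t)), (- b'), (- a'); split; rewrite ?ltrN2 //.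
  exact: smooth_curve_opp.
move=> t ht; have htN : a <= - t <= b by rewrite lerNr lerNl andbC.
have [dc [v [vel cv Tv]]] := hd _ htN; split=> //; exists (opp_tangent v).
split; [|exact/trans_causal_opp/trans_causal_lt|exact: TT1].
(* The closed piece lies inside the larger open interval where [d] is smooth, so its endpoints cause
   no trouble. *)
rewrite -[t]opprK; apply: velocity_opp smooth_d _ vel.
by case/andP: htN => ? ?; rewrite (lt_le_trans aa') // (le_lt_trans _ bb').
Qed.

Lemma future_causal_curve_opp c a b : (forall v, T v -> T1 (opp_tangent v)) ->
  future_causal_curve F h T c a b ->
  future_causal_curve F g1 T1 (fun t => c (- t)) (- b) (- a).
Proof.
move=> TT1 [ts path_ts pieces].
(* The breakpoints are negated and listed backwards; piece [i] of the new curve is the reversal of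
   piece [size ts - i] of the old one. *)
pose s := a :: rcons ts b; pose ts' := rev (map -%R ts).
have sE : - b :: rcons ts' (- a) = rev (map -%R s).
  by rewrite /= rev_cons map_rcons rev_rcons.
exists ts' => [|i hi].
  change (sorted <%R (- b :: rcons ts' (- a))).
  rewrite sE rev_sorted sorted_map /=.
  by apply: sub_path path_ts => x y /=; rewrite ltrN2.
rewrite sE; have sz : size s = (size ts).+2 by rewrite /= size_rcons.
rewrite size_rev size_map in hi.
have nthE j : (j < size s)%N ->
    nth 0 (rev (map -%R s)) j = - nth 0 s (size s - j.+1).
  by move=> js; rewrite nth_rev size_map // (nth_map 0) // ltn_subrL sz.
rewrite !nthE ?sz ?subSS //; last by rewrite ltnW.
have := future_causal_piece_opp TT1 (pieces (size ts - i)%N (leq_subr _ _)).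
by rewrite subSn.
Qed.

(** A reversed curve exchanges its endpoints, which is harmless since both lie on the same leaf. *)
Lemma transversely_causal_lt :
  T `<=` T1 \/ (forall v, T v -> T1 (opp_tangent v)) ->
  transversely_causal F g1 T1 -> transversely_causal F h T.
Proof.
move=> TT1 causal x [c [a [b [hc La Lb]]]]; apply: (causal x).
case: TT1 => TT1.
  by exists c, a, b; split=> //; exact: future_causal_curve_sub hc.
exists (fun t => c (- t)), (- b), (- a); rewrite !opprK.
by split=> //; exact: future_causal_curve_opp hc.
Qed.

End CausalCurves.

Theorem corollary5p6 (R : realType) (n q : nat) (hn : (3 <= n)%N)
    (hq : (2 <= q)%N) (M : smooth_manifold R n)
    (hM : connected [set: M])
    (F : foliation M q) (g : symfield M) (T : set (tangent M))
    (hg : transverse_lorentzian F g) (hT : time_orientation F g T)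
    (hstable : transversely_stably_causal F g T) :
  exists U : set (symfield M),
    C0_neighborhood F g U /\
    forall g', U g' -> orientable_and_transversely_causal F g'.
Proof.
have [g1 [T1 [hg1 lt hT1 _ causal]]] := hstable.
(* The transverse metrics with values in the open set [below g1]; on transverse metrics this amounts
   to [h < g1], so [g] belongs to it. *)
exists [set h | transverse_lorentzian F h /\ forall x, below (q := q) g1 (h x)].
split.
  split=> [h [] //|]; exists (below (q := q) g1); split=> // [|x].
    exact: open_below.
  exact: metric_lt_below hg hg1 lt.
move=> h [hh /(below_metric_lt hh hg1) hlt].
split.
  by exists (trans_causal F h `&` T1); exact: time_orientation_lt hlt.
move=> T' hT'; apply: (transversely_causal_lt hg1 hlt _ causal).
exact: orientation_dichotomy hlt _ hM hT'.
Qed.
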